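(* Let $G=(V,E)$ be an unweighted planar graph (with a fixed planar embedding), and let $S=(s_1,s_2,\dots,s_\ell)$ be consecutive vertices on a face, ordered in clockwise or counter-clockwise order. For each $i\in[\ell-1]$ and $\Delta\in\{-1,0\}$ define $A_i^\Delta=\{v\in V: d(v,s_i)\le d(v,s_{i+1})+\Delta\}$. Define the universe $X=[\ell]\times\{-1,0\}$ and the family $\mathcal F(S)=\{\{(i,\Delta): v\in A_i^\Delta\}: v\in V\}\subseteq 2^X$. Then the VC dimension of $\mathcal F(S)$ on universe $X$ is at most $3$.
   Context: $d(\cdot,\cdot)$ is the hop distance in $G$. A family $\mathcal F$ of subsets of a universe $X$ has VC dimension $k$ if $k$ is the largest size of a set $Y\subseteq X$ such that for every $Y'\subseteq Y$ there is $F\in\mathcal F$ with $Y\cap F=Y'$. *)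

(* Defs.v *)
From HB Require Import structures.
From mathcomp Require Import all_boot all_order all_algebra all_fingroup.
From mathcomp Require Import constructive_ereal.

Set Implicit Arguments.
Unset Strict Implicit.
Unset Printing Implicit Defensive.

Record sgraph := SGraph {
  vertex :> finType;
  adj : rel vertex;
  adj_sym : symmetric adj;
  adj_irr : irreflexive adj
}.

Section Distance.
Variable G : sgraph.
Implicit Types u v : G.

Definition walk_of_length u v (n : nat) : bool :=
  [exists p : n.-tuple G, path (@adj G) u p && (last u p == v)].

Lemma connect_walk u v :
  connect (@adj G) u v -> exists n, walk_of_length u v n.
Proof.
case/connectP=> p up ->; exists (size p).
by apply/existsP; exists (in_tuple p); rewrite up eqxx.
Qed.

(* +oo between distinct connected components *)
Definition dist u v : \bar int :=
  match boolP (connect (@adj G) u v) with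
  | AltTrue uv => (Posz (ex_minn (connect_walk uv)))%:E
  | AltFalse _ => +oo%E
  end.

End Distance.

(* Planar embeddings are combinatorial maps of genus 0: a rotation system,
   that is a cyclic order of the darts (oriented edges) leaving each vertex,
   whose faces satisfy Euler's formula. *)
Section Embedding.
Variable G : sgraph.

Definition dart := {a : G * G | adj a.1 a.2}.
Definition src (a : dart) : G := (val a).1.

Lemma rev_dart_subproof (a : dart) : adj (val a).2 (val a).1.
Proof. by rewrite adj_sym; exact: valP a. Qed.

Definition rev_dart (a : dart) : dart :=
  Sub ((val a).2, (val a).1) (rev_dart_subproof a).

Lemma rev_dartK : involutive rev_dart.
Proof. by move=> a; apply: val_inj; case: a => -[]. Qed.

Definition rev_perm : {perm dart} := perm (inv_inj rev_dartK).

Record rotation_system := RotationSystem {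
  rot_perm :> {perm dart};
  rot_permP : forall a, porbit rot_perm a = [set b | src b == src a]
}.

(* Maps a dart u -> v to the dart following v -> u in the rotation at v; its
   cycles are the boundary walks of the faces. *)
Definition face_perm (M : rotation_system) : {perm dart} :=
  (rev_perm * M)%g.

Definition isolated (x : G) : bool := [forall y, ~~ adj x y].

(* Each connected component is drawn on its own sphere, so that Euler's formula
   reads V + F = E + 2 C; an isolated vertex has no dart and contributes one
   face. In a plane drawing of a graph with several components a face is the
   merge of several of these faces, with the same boundary walks. *)
Definition face_count (M : rotation_system) : nat :=
  #|porbits (face_perm M)| + #|[set x : G | isolated x]|.

Record planar_embedding := PlanarEmbedding {
  rotation :> rotation_system;
  euler_formula :
    #|G| + face_count rotation = #|{: dart}|./2 + 2 * n_comp (@adj G) predT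
}.

(* The vertices met in one turn around a face, from an arbitrary start; a
   vertex occurs once for each of its corners in the face. *)
Definition boundary_walk (M : rotation_system) (w : seq G) : Prop :=
  (exists2 x : G, isolated x & w = [:: x]) \/
  (exists a : dart,
     w = [seq src b | b <- traject (face_perm M) a #|porbit (face_perm M) a|]).

Definition consecutive_on_face (M : rotation_system) (s : seq G) : Prop :=
  exists2 w, boundary_walk M w & prefix s w \/ prefix s (rev w).

End Embedding.

Section VCDimension.
Variable X : finType.

Definition shattered (F : {set {set X}}) (Y : {set X}) : bool :=
  [forall Y' : {set X}, (Y' \subset Y) ==> [exists A in F, Y :&: A == Y']].

Definition VC_dim (F : {set {set X}}) : nat :=
  \max_(Y : {set X} | shattered F Y) #|Y|.

End VCDimension.

Definition Delta_type := seq_sub [:: (-1)%R : int; 0%R].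
Definition Delta_val (D : Delta_type) : int := ssval D.

Section Family.
Variables (G : sgraph) (l : nat) (s : l.-tuple G).

(* [halfset i j D] is the set A_i^D when j is the successor of i. *)
Definition halfset (i j : 'I_l) (D : int) : {set G} :=
  [set v : G | (dist v (tnth s i) <= dist v (tnth s j) + D%:E)%E].

Definition universe : finType := ('I_l * Delta_type)%type.

(* A_i^D is only defined when s_(i+1) exists: pairs whose first component is
   the last index belong to the universe but to no member of the family. *)
Definition pattern (v : G) : {set universe} :=
  [set p : universe | [exists j : 'I_l,
     (j == p.1.+1 :> nat) && (v \in halfset p.1 j (Delta_val p.2))]].

Definition distance_family : {set {set universe}} := [set pattern v | v : G].

End Family.

(* Main.v *)
Require Import Defs.
From mathcomp Require Import all_boot all_order all_algebra all_fingroup.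
From mathcomp Require Import constructive_ereal zify ring lra.

(* Let u and v realise the complementary patterns 1010 and 0101 on four elements
   of the universe with increasing indices. Then d(u, s_i) - d(v, s_i) goes
   strictly up, down, up and down along S, so there are four positions in cyclic
   order on the face at which its values are alternately low and high, both lows
   being below both highs. A geodesic from u to a low position cannot meet a
   geodesic from v to a high one (exchanging their tails would shorten the total
   length), which contradicts the Jordan property: two walks joining
   interleaved corners of a face share a vertex.

   The Jordan property is proved homologically. If the walks were disjoint, the
   first one, closed up by a chord through the face, would be a cycle; by
   Euler's formula and a rank count this cycle is the jump of a potential on
   darts, which is constant along the second walk but changes by 1 between its
   two ends. *)

Set Implicit Arguments.
Unset Strict Implicit.
Unset Printing Implicit Defensive.

Import GRing.Theory.

(** * Linear algebra: exactness from a dimension count *)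

Section ExactSequence.
Local Open Scope ring_scope.

Lemma mxrank_row_mx_le (F : fieldType) m n p (A : 'M[F]_(m, n))
    (B : 'M[F]_(m, p)) : (\rank (row_mx A B) <= \rank A + \rank B)%N.
Proof.
rewrite -mxrank_tr tr_row_mx -addsmxE -[\rank A]mxrank_tr -[\rank B]mxrank_tr.
exact: mxrank_adds_leqif.
Qed.

(** Vectors of the left kernel of [A] are determined by their coordinates in [R], so this kernel has
    dimension at most [#|R|]: adjoining to [A] the columns [E] that read off these coordinates makes
    it row free. *)
Lemma leq_rank_restr (F : fieldType) (I J : finType) (a : I -> J -> F)
    (R : {set I})
    (A := \matrix_(i < #|I|, j < #|J|) a (enum_val i) (enum_val j)) :
  (forall h : I -> F, (forall j, \sum_i h i * a i j = 0) ->
     (forall i, i \in R -> h i = 0) -> forall i, h i = 0) ->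
  (#|I| <= \rank A + #|R|)%N.
Proof.
move=> inj_a.
pose E := \matrix_(i < #|I|, j < #|R|)
  ((enum_val i == enum_val j)%:R : F).
suff: row_free (row_mx A E).
  rewrite /row_free => /eqP {1}<-.
  by apply: leq_trans (mxrank_row_mx_le A E) _; rewrite leq_add2l rank_leq_col.
rewrite -kermx_eq0; apply/rowV0P => h /sub_kermxP.
rewrite mul_mx_row -[0]row_mx0 => /eq_row_mx[hA hE].
suff h0 i : h 0 (enum_rank i) = 0.
  by apply/rowP => i; rewrite mxE -[i]enum_valK h0.
move: i; apply: inj_a => [j|i iR].
  move/matrixP/(_ 0 (enum_rank j)): hA; rewrite !mxE => hA; rewrite -[RHS]hA.
  rewrite (reindex _ (onW_bij _ (@enum_val_bij I))) /=; apply: eq_bigr => i _.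
  by rewrite !mxE enum_valK enum_rankK.
move/matrixP/(_ 0 (enum_rank_in iR i)): hE; rewrite !mxE => hE;
    rewrite -[RHS]hE.
rewrite (bigD1 (enum_rank i)) //= !mxE enum_rankK enum_rankK_in // eqxx mulr1.
rewrite big1 ?addr0 // => k /negPf ki; rewrite !mxE enum_rankK_in //.
by rewrite (can2_eq enum_valK enum_rankK) ki mulr0.
Qed.

(* Exactness in the middle of F^I -> F^J -> F^K, by counting ranks: the sets R
   and S bound the dimensions of the outer kernel and cokernel. *)
Lemma exact_of_card (F : fieldType) (I J K : finType)
    (a : I -> J -> F) (b : J -> K -> F) (R : {set I}) (S : {set K}) :
  (forall i k, \sum_j a i j * b j k = 0) ->
  (forall h : I -> F, (forall j, \sum_i h i * a i j = 0) ->
     (forall i, i \in R -> h i = 0) -> forall i, h i = 0) ->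
  (forall g : K -> F, (forall j, \sum_k g k * b j k = 0) ->
     (forall k, k \in S -> g k = 0) -> forall k, g k = 0) ->
  (#|J| + #|R| + #|S| <= #|I| + #|K|)%N ->
  forall z : J -> F, (forall k, \sum_j z j * b j k = 0) ->
  exists h : I -> F, forall j, \sum_i h i * a i j = z j.
Proof.
move=> ab0 inj_a inj_b card_le z zb0.
have rA := leq_rank_restr inj_a.
have rB := @leq_rank_restr F K J (fun k j => b j k) S inj_b.
set A := (\matrix_(_, _) _) in rA; set Bt := (\matrix_(_, _) _) in rB.
have AB0 : A *m Bt^T = 0.
  apply/matrixP => i k; rewrite !mxE -[RHS](ab0 (enum_val i) (enum_val k)).
  rewrite [RHS](reindex _ (onW_bij _ (@enum_val_bij J))) /=.
  by apply: eq_bigr => j _; rewrite !mxE.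
pose zv : 'rV_#|J| := \row_j z (enum_val j).
have zB0 : zv *m Bt^T = 0.
  apply/matrixP => i k; rewrite !mxE -[RHS](zb0 (enum_val k)).
  rewrite [RHS](reindex _ (onW_bij _ (@enum_val_bij J))) /=.
  by apply: eq_bigr => j _; rewrite !mxE.
have sAK : (A <= kermx Bt^T)%MS by apply/sub_kermxP.
(* By ranks: the kernel has dimension [#|J| - \rank Bt], at most [#|J| + #|S| - #|K|], hence at most
   [#|I| - #|R| <= \rank A]. *)
have sKA : (kermx Bt^T <= A)%MS.
  rewrite -(geq_leqif (mxrank_leqif_sup sAK)) mxrank_ker mxrank_tr.
  rewrite leq_subLR; move: rA rB card_le; lia.
have /submxP[h zE] : (zv <= A)%MS.
  by apply: submx_trans sKA; apply/sub_kermxP.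
exists (fun i => h 0 (enum_rank i)) => j.
move/matrixP/(_ 0 (enum_rank j)): zE; rewrite !mxE enum_rankK => ->.
rewrite (reindex _ (onW_bij _ (@enum_val_bij I))) /=.
by apply: eq_bigr => i _; rewrite !mxE enum_valK enum_rankK.
Qed.

End ExactSequence.

(** * Potentials on the darts of a planar embedding *)

Section Potential.
Variables (G : sgraph) (M : planar_embedding G).
Implicit Types (d e : dart G).
Local Notation rev := (rev_perm G).
Local Notation face := (face_perm M).
Local Open Scope ring_scope.

Lemma rev_permE d : rev d = rev_dart d.
Proof. by rewrite permE. Qed.

Lemma face_permE d : face d = M (rev d).
Proof. by rewrite /face_perm permM. Qed.

Lemma src_rot d : src (M d) = src d.
Proof.
have: M d \in porbit M d by exact: (mem_porbit M 1).
by rewrite rot_permP inE => /eqP.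
Qed.

Lemma adj_src_rev d : adj (src d) (src (rev d)).
Proof. by rewrite rev_permE; exact: (valP d). Qed.

Lemma src_face d : src (face d) = src (rev d).
Proof. by rewrite face_permE src_rot. Qed.

Lemma rev_permK d : rev (rev d) = d.
Proof. by rewrite !rev_permE rev_dartK. Qed.

(** Since [adj] is irreflexive, [rev] fixes no dart; its orbits are the edges, with two darts
    each. *)
Lemma card_dart : #|{: dart G}| = (2 * #|porbits rev|)%N.
Proof.
have tr : trivIset (porbits rev).
  apply/trivIsetP => _ _ /imsetP[d _ ->] /imsetP[e _ ->]; apply: contraR.
  case/pred0Pn => x /andP[/= xd xe].
  by move: xd xe; rewrite -!eq_porbit_mem => /eqP<- /eqP<-.
have cov : cover (porbits rev) = [set: dart G].
  apply/setP => d; rewrite inE; apply/bigcupP; exists (porbit rev d).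
    exact: imset_f.
  exact: porbit_id.
have -> : #|{: dart G}| = #|cover (porbits rev)| by rewrite cov cardsT.
move/eqP: tr => <-.
rewrite mulnC -sum_nat_const; apply: eq_bigr => _ /imsetP[d _ ->].
have -> : porbit rev d = [set d; rev d].
  apply/setP => e; rewrite !inE; apply/porbitP/orP => [[i ->]|].
    elim: i => [|i IH]; first by left; rewrite expg0 perm1.
    rewrite expgSr permM; case: IH => /eqP ->; first by right.
    by left; rewrite rev_permK.
  case=> /eqP ->; first by exists 0%N; rewrite expg0 perm1.
  by exists 1%N; rewrite expg1.
rewrite cards2; suff -> : d != rev d by [].
by apply/eqP => dE; have := adj_src_rev d; rewrite -dE adj_irr.
Qed.

(** The rotation is [rev] followed by [face], so [h] depends only on the source of a dart; [rev]
    then carries its value across each edge. *)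
Lemma dart_invariant_connect (T : Type) (h : dart G -> T) :
  (forall d, h (rev d) = h d) -> (forall d, h (face d) = h d) ->
  forall d e, connect (@adj G) (src d) (src e) -> h d = h e.
Proof.
move=> hrev hface.
have hrot d : h (M d) = h d.
  by rewrite -hrev -[in LHS](rev_permK d) -face_permE hrev hface hrev.
have hsrc d e : src d = src e -> h d = h e.
  move=> de; have: e \in porbit M d by rewrite rot_permP inE de.
  case/porbitP => i ->; elim: i => [|i IH]; first by rewrite expg0 perm1.
  by rewrite expgSr permM hrot.
move=> d e /connectP[p]; elim: p d => [|x p IH] d /=; first by move=> _ /hsrc.
case/andP => dx px ex.
pose d' : dart G := Sub (src d, x) dx.
have -> : h d = h (rev d') by rewrite hrev; apply: hsrc.
by apply: IH; rewrite rev_permE.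
Qed.

Lemma adj_connect_sym : connect_sym (@adj G).
Proof. exact: sym_connect_sym (@adj_sym G). Qed.

Lemma isolated_root x : isolated x -> x \in roots (@adj G).
Proof.
move/forallP => isox; rewrite inE; apply/eqP.
have /connectP[[|y p] /=] := connect_root (@adj G) x; first by [].
by rewrite (negPf (isox y)).
Qed.

Lemma exists_dart x : ~~ isolated x -> exists d : dart G, src d = x.
Proof.
rewrite negb_forall => /existsP[y]; rewrite negbK => xy.
by exists (Sub (x, y) xy).
Qed.

Lemma nonisolated_root d : ~~ isolated (fingraph.root (@adj G) (src d)).
Proof.
apply/negP => /forallP isor.
have := connect_root (@adj G) (src d); rewrite adj_connect_sym.
case/connectP => -[|y p] /=; last by rewrite (negPf (isor y)).
by move=> _ dr; have := isor (src (rev d)); rewrite -dr adj_src_rev.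
Qed.

Lemma sum_indicator (R : pzRingType) (I : finType) (c : I -> R) x :
  \sum_i (x == i)%:R * c i = c x.
Proof.
rewrite (bigD1 x) //= eqxx mul1r big1 ?addr0 // => i.
by rewrite eq_sym => /negPf ->; rewrite mul0r.
Qed.

Definition diff_coef (s : {perm dart G}) d e : rat :=
    (s e == d)%:R - (e == d)%:R.

Lemma sum_diff_coefl (s : {perm dart G}) (h : dart G -> rat) e :
  \sum_d h d * diff_coef s d e = h (s e) - h e.
Proof.
under eq_bigr => d _ do rewrite mulrC mulrBl.
by rewrite sumrB !sum_indicator.
Qed.

Lemma sum_diff_coefr (s : {perm dart G}) (c : dart G -> rat) d :
  \sum_e diff_coef s d e * c e = c ((s^-1)%g d) - c d.
Proof.
under eq_bigr => e _ do rewrite mulrBl.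
rewrite sumrB -[in RHS](sum_indicator c d) -[in RHS](sum_indicator c (_ d)).
congr (_ - _); apply: eq_bigr => e _; last by rewrite eq_sym.
by rewrite (can2_eq (permK s) (permKV s)) eq_sym.
Qed.

(** Jumps of a potential: from [d] to [rev d] on the left, from [d] to [face d] on the right. *)
Let chains := (dart G + dart G)%type.
Let relations := ({set dart G} + {set dart G} + G)%type.

Definition jump_coef d (j : chains) : rat :=
  match j with inl e => diff_coef rev d e | inr e => diff_coef face d e end.

(* Sets of darts index the relations attached to the orbits of [rev] and
   [face]; those that are not orbits index the trivial relation. *)
Definition relation_coef (j : chains) (k : relations) : rat :=
  match j, k with
  | inl e, inl (inl B) => ((B \in porbits rev) && (e \in B))%:R
  | inl e, inr x => (src e == x)%:R
  | inr e, inl (inr B) => ((B \in porbits face) && (e \in B))%:R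
  | inr e, inr x => (src (rev e) == x)%:R
  | _, _ => 0
  end.

Lemma mem_porbits_perm (s : {perm dart G}) B d :
  B \in porbits s -> ((s^-1)%g d \in B) = (d \in B).
Proof.
case/imsetP => e _ ->; rewrite -!eq_porbit_mem.
by rewrite -(porbit_perm s 1 ((s^-1)%g d)) expg1 permKV.
Qed.

(** Jumps telescope around an orbit. They also do around a vertex, where a [rev] jump followed by a
    [face] jump is one step of the rotation. *)
Lemma jump_relation d k : \sum_j jump_coef d j * relation_coef j k = 0.
Proof.
rewrite big_sumType; case: k => [[B|B]|x] /=; rewrite !sum_diff_coefr.
- have [/(mem_porbits_perm (s := rev)) ->|] := boolP (B \in porbits rev);
    by rewrite !subrr.
- have [/(mem_porbits_perm (s := face)) ->|] := boolP (B \in porbits face);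
    by rewrite !subrr.
rewrite -[in X in _ + (X - _)](src_face) permKV.
have -> : (rev^-1)%g d = rev d by apply: (canLR (permK rev)); rewrite rev_permK.
ring.
Qed.

Lemma sum_orbit_indicator (s : {perm dart G}) (c : {set dart G} -> rat) e :
  \sum_B c B * ((B \in porbits s) && (e \in B))%:R = c (porbit s e).
Proof.
rewrite -[RHS]sum_indicator; apply: eq_bigr => B _; rewrite mulrC.
congr (_%:R * _); congr nat_of_bool; apply/andP/eqP => [[/imsetP[d _ ->]]|<-].
  by rewrite -eq_porbit_mem => /eqP.
by rewrite imset_f // porbit_id.
Qed.

Lemma sum_relation_coef (g : relations -> rat) j :
  \sum_k g k * relation_coef j k =
  match j with
  | inl e => g (inl (inl (porbit rev e))) + g (inr (src e))
  | inr e => g (inl (inr (porbit face e))) + g (inr (src (rev e)))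
  end.
Proof.
case: j => e; rewrite !big_sumType /=.
- rewrite (sum_orbit_indicator rev (fun B => g (inl (inl B)))).
  rewrite [X in _ + X + _]big1 ?addr0; last by move=> B _; rewrite mulr0.
  congr (_ + _); rewrite -(sum_indicator (fun x => g (inr x))).
  by apply: eq_bigr => x _; rewrite mulrC.
rewrite (sum_orbit_indicator face (fun B => g (inl (inr B)))).
rewrite [X in X + _ + _]big1 ?add0r; last by move=> B _; rewrite mulr0.
congr (_ + _); rewrite -(sum_indicator (fun x => g (inr x))).
by apply: eq_bigr => x _; rewrite mulrC.
Qed.

(** One dart, chosen by [pick], at the root of each component that has an edge. Its values determine
    a function constant on components. *)
Definition root_darts : {set dart G} :=
  [set d | (src d \in roots (@adj G)) &&
           ([pick e : dart G | src e == src d] == Some d)].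

(** Coordinates that determine a linear dependency between relations: the non-orbits, and one vertex
    per component. *)
Definition trivial_relations : {set relations} :=
  [set k : relations | match k with
    | inl (inl B) => B \notin porbits rev
    | inl (inr B) => B \notin porbits face
    | inr x => x \in roots (@adj G)
    end].

Lemma card_roots : n_comp (@adj G) predT = #|[set x | x \in roots (@adj G)]|.
Proof.
by rewrite cardsE /n_comp_mem; apply: eq_card => x; rewrite !inE andbT.
Qed.

(** Isolated vertices are roots without darts, so the two sets embed disjointly into the roots. *)
Lemma card_root_darts :
  (#|root_darts| + #|[set x : G | isolated x]| <= n_comp (@adj G) predT)%N.
Proof.
have inj : {in root_darts &, injective (@src G)}.
  move=> d e; rewrite !inE => /andP[_ /eqP pd] /andP[_ /eqP pe] de.
  by apply: Some_inj; rewrite -pd -pe de.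
rewrite card_roots -(card_in_imset inj) -cardsUI.
rewrite [X in (_ + X)%N](_ : _ = 0%N) ?addn0.
  apply/subset_leq_card/subsetP => x; rewrite in_setU => /orP[/imsetP[d]|].
    by move=> dR ->; move: dR; rewrite !inE => /andP[].
  by rewrite !in_set => /isolated_root.
apply/eqP; rewrite cards_eq0 -subset0; apply/subsetP => x.
rewrite !inE => /andP[/imsetP[d _ ->]] /forallP/(_ (src (rev d))).
by rewrite adj_src_rev.
Qed.

Lemma card_trivial_relations :
  (#|trivial_relations| + #|porbits rev| + #|porbits face| + #|G| =
   #|{: relations}| + n_comp (@adj G) predT)%N.
Proof.
have -> : #|trivial_relations| =
    (#|~: porbits rev| + #|~: porbits face| + n_comp (@adj G) predT)%N.
  rewrite -sum1_card big_mkcond big_sumType big_sumType /= card_roots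
      -!sum1_card.
  by congr (_ + _ + _)%N; rewrite [RHS]big_mkcond; apply: eq_bigr => x _;
      rewrite !inE.
rewrite !card_sum; have := cardsC (porbits rev); have := cardsC (porbits face);
    lia.
Qed.

(* The first cohomology of the sphere vanishes: a cochain with zero sum around
   every edge, face and vertex is a coboundary. *)
Lemma exists_potential (x y : dart G -> rat) :
  (forall d, x (rev d) = - x d) ->
  (forall d, \sum_(e in porbit face d) y e = 0) ->
  (forall v : G, \sum_(d | src d == v) (x d + y (rev d)) = 0) ->
  exists h : dart G -> rat,
    (forall d, h (rev d) - h d = x d) /\ (forall d, h (face d) - h d = y d).
Proof.
move=> xrev yface xyv.
pose z (j : chains) := match j with inl e => x e | inr e => y e end.
have [||||h hz] := @exact_of_card rat _ _ _ jump_coef relation_coef root_darts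
    trivial_relations jump_relation _ _ _ z _.
(* A potential without jumps is constant on each component, hence zero if it vanishes on the root
   darts. *)
- move=> h h0 hR d.
  have hinv (s : {perm dart G}) :
      (forall e, \sum_d h d * diff_coef s d e = 0) -> forall e, h (s e) = h e.
    by move=> hs e; apply/eqP; rewrite -subr_eq0 -sum_diff_coefl hs.
  have hcon := dart_invariant_connect (hinv rev (fun e => h0 (inl e)))
    (hinv face (fun e => h0 (inr e))).
  have [e0 e0r] := exists_dart (nonisolated_root d).
  case pe: [pick e : dart G | src e == src e0] => [e|]; last first.
    by move: pe; case: pickP => // /(_ e0); rewrite eqxx.
  have ee0 : src e = src e0 by move: pe; case: pickP => // ? /eqP ? [<-].
  rewrite (hcon d e); last by rewrite ee0 e0r connect_root.
  by apply: hR; rewrite in_set ee0 pe eqxx e0r andbT;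
      exact: roots_root adj_connect_sym _.
(* A dependency takes at both ends of an edge the opposite of its value at the edge; so it is
   constant on the vertices of a component, and zero there because it vanishes at the root. *)
- move=> g g0 gS.
  have gl e : g (inl (inl (porbit rev e))) + g (inr (src e)) = 0.
    by rewrite -(sum_relation_coef g (inl e)) g0.
  have gr e : g (inl (inr (porbit face e))) + g (inr (src (rev e))) = 0.
    by rewrite -(sum_relation_coef g (inr e)) g0.
  have gadj v w : adj v w -> g (inr v) = g (inr w).
    move=> vw; pose d : dart G := Sub (v, w) vw.
    have := gl (rev d); have := porbit_perm rev 1 d; rewrite expg1 => ->.
    by move/eqP; rewrite -(gl d) rev_permE => /eqP /addrI /=.
  have gV v : g (inr v) = 0.
    have /connectP[p] := connect_root (@adj G) v.
    have := roots_root adj_connect_sym v; move: (fingraph.root _ v) => r rr.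
    elim: p v => [|w p IH] v /=.
      by move=> _ rv; apply: gS; rewrite in_set -rv.
    by case/andP => /gadj -> /IH; apply.
  case=> [[B|B]|v //].
    have [/imsetP[e _ ->]|B'] := boolP (B \in porbits rev); last by apply: gS;
        rewrite inE.
    by rewrite -[LHS]addr0 -(gV (src e)) gl gV.
  have [/imsetP[e _ ->]|B'] := boolP (B \in porbits face); last by apply: gS;
      rewrite inE.
  by rewrite -[LHS]addr0 -(gV (src (rev e))) gr gV.
(* With V vertices, E edges, F orbits of [face] and C components, the bound reduces to
   [E + #|root_darts| + C <= V + F], which follows from Euler's formula and [card_root_darts]. *)
- have := card_trivial_relations; have := card_root_darts; have := card_dart.
  have := euler_formula M; rewrite /face_count.
  move=> eul cD cR cT; rewrite [#|{: dart G + dart G}|]card_sum.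
  change (#|{: dart G}| + #|{: dart G}| + #|root_darts| + #|trivial_relations|
    <= #|{: dart G}| + #|{: relations}|)%N.
  by move: eul cD cR cT; lia.
- have sum_ind (P : pred (dart G)) (c : dart G -> rat) :
      \sum_e c e * (P e)%:R = \sum_(e | P e) c e.
    by rewrite [RHS]big_mkcond; apply: eq_bigr => e _; case: (P e);
        rewrite ?mulr1 ?mulr0.
  move=> k; rewrite big_sumType; case: k => [[B|B]|v] /=.
  (* Reindexing by [rev] preserves an edge and negates [x], so the sum is its own opposite. *)
  + rewrite [X in _ + X]big1 ?addr0; last by move=> e _; rewrite mulr0.
    rewrite sum_ind; set S := LHS; suff: S = - S by lra.
    rewrite {1}/S (reindex_inj (@perm_inj _ rev)) -sumrN.
    apply: eq_big => e; last by rewrite xrev.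
    have [BO|//] := boolP (B \in porbits rev).
    by rewrite -(mem_porbits_perm _ BO) permK.
  + rewrite big1 ?add0r; last by move=> e _; rewrite mulr0.
    rewrite sum_ind; have [/imsetP[d _ ->]|B'] := boolP (B \in porbits face).
      exact: yface.
    by rewrite big_pred0.
  rewrite [X in _ + X](reindex_inj (@perm_inj _ rev)) /=.
  under [X in _ + X]eq_bigr => e _ do rewrite rev_permK.
  by rewrite !sum_ind -big_split.
exists h; split => d; first by rewrite -sum_diff_coefl (hz (inl d)).
by rewrite -sum_diff_coefl (hz (inr d)).
Qed.
End Potential.

(** * Walks between interleaved corners of a face *)

Section Crossing.
Variables (G : sgraph) (M : planar_embedding G).
Implicit Types (d e : dart G) (u v w : G) (p q : seq G).
Local Notation rev := (rev_perm G).
Local Notation face := (face_perm M).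
Local Open Scope ring_scope.

(** The walk as an antisymmetric 1-chain: forward minus backward traversals of each dart. *)
Fixpoint flow u p d : rat :=
  if p is v :: p' then
    (val d == (u, v))%:R - (val d == (v, u))%:R + flow v p' d
  else 0.

Lemma flow_rev u p d : flow u p (rev d) = - flow u p d.
Proof.
elim: p u => [|v p IH] u /=; first by rewrite oppr0.
rewrite IH rev_permE opprD opprB; congr (_ - _ + _).
  by case: d {IH} => -[? ?] ?; rewrite /= !xpair_eqE andbC.
by case: d {IH} => -[? ?] ?; rewrite /= !xpair_eqE andbC.
Qed.

Lemma flow_notin u p d : src d \notin u :: p -> flow u p d = 0.
Proof.
elim: p u => [//|v p IH] u; rewrite 2!in_cons !negb_or => /and3P[du dv dp] /=.
rewrite IH ?in_cons ?negb_or ?dv // addr0.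
case: d {IH dp} du dv => -[a b] ab; rewrite /src /= => du dv.
move: du dv; rewrite !xpair_eqE => /negPf -> /negPf ->.
by rewrite subrr.
Qed.

Lemma sum_arc u v w : adj u v ->
  \sum_(d : dart G | src d == w) (val d == (u, v))%:R = (u == w)%:R :> rat.
Proof.
move=> uv; pose d0 : dart G := Sub (u, v) uv.
rewrite big_mkcond (bigD1 d0) //= eqxx big1 ?addr0 => [|d dd0].
  by rewrite /src /=; case: (u == w).
case: ifP => // _; suff /negPf -> : val d != (u, v) by [].
by apply: contra dd0 => /eqP dE; apply/eqP/val_inj.
Qed.

Lemma flow_outflow u p w : path (@adj G) u p ->
  \sum_(d : dart G | src d == w) flow u p d = (u == w)%:R - (last u p == w)%:R.
Proof.
elim: p u => [|v p IH] u /=; first by move=> _; rewrite big1 ?subrr.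
case/andP => uv vp; rewrite big_split sumrB /= IH // !sum_arc //.
  ring.
by rewrite adj_sym.
Qed.

Lemma iter_face_inj a i j : (i < #|porbit face a|)%N ->
    (j < #|porbit face a|)%N ->
  (iter i face a == iter j face a) = (i == j).
Proof.
move=> li lj; rewrite -(nth_traject _ li) -(nth_traject _ lj).
by rewrite nth_uniq ?size_traject ?uniq_traject_porbit.
Qed.

Lemma mem_iter_porbit (s : {perm dart G}) a i d :
  (iter i s a \in porbit s d) = (a \in porbit s d).
Proof. by rewrite -permX -!eq_porbit_mem porbit_perm. Qed.

Lemma sum_perm_eq (s : {perm dart G}) (P : pred (dart G)) c :
  (forall d, P (s d) = P d) -> \sum_(d | P d) (s d == c)%:R = (P c)%:R :> rat.
Proof.
move=> Ps; rewrite big_mkcond (bigD1 ((s^-1)%g c)) //= -Ps permKV eqxx.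
rewrite big1 ?addr0; first by case: (P c).
move=> d dc; case: ifP => // _; case: eqP => // sdc.
by move: dc; rewrite -sdc permK eqxx.
Qed.

Lemma face_paths_cross a i j k m p q (v := fun t => src (iter t face a)) :
  (i < j)%N -> (j < k)%N -> (k < m)%N -> (m < #|porbit face a|)%N ->
  path (@adj G) (v i) p -> last (v i) p = v k ->
  path (@adj G) (v j) q -> last (v j) q = v m ->
  exists2 z, z \in v i :: p & z \in v j :: q.
Proof.
move=> ij jk km mN pp pl qp ql.
have [/hasP[z zq zp]|/hasPn disj] := boolP (has (mem (v i :: p)) (v j :: q)).
  by exists z.
exfalso.
(* The chord closing [p] through the face: a unit jump on the face step arriving at corner [k] and
   its opposite at corner [i]. It cancels the outflow of [p] at its two ends. *)
pose y d : rat := (face d == iter k face a)%:R - (face d == iter i face a)%:R.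
have [d|d|w|h [hrev hface]] := @exists_potential G M (flow (v i) p) y.
- exact: flow_rev.
- have inv e : (face e \in porbit face d) = (e \in porbit face d).
    exact: (mem_iter_porbit face e 1 d).
  by rewrite sumrB !(sum_perm_eq (s := face)) // !mem_iter_porbit subrr.
- rewrite big_split /= flow_outflow // pl.
  under [X in _ + X]eq_bigr => d _ do rewrite /y !face_permE rev_permK.
  rewrite sumrB !(sum_perm_eq (s := M)); try by move=> d; rewrite src_rot.
  rewrite -/(v i) -/(v k); ring.
have kP : v k \in v i :: p by rewrite -pl mem_last.
(* Off [p] the flow vanishes, and so does the chord, whose ends lie on [p]. *)
have hrot d : src d \notin v i :: p -> h (M d) = h d.
  move=> dP; have := hface (rev d); have := hrev d.
  rewrite face_permE rev_permK (flow_notin dP) /y !face_permE rev_permK.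
  have neq t : v t \in v i :: p -> (M d == iter t face a) = false.
    by move=> tP; apply: contraNF dP => /eqP de; rewrite -(src_rot M) de.
  rewrite !neq ?mem_head //; lra.
have hsrc d e : src d \notin v i :: p -> src d = src e -> h d = h e.
  move=> dP de; have: e \in porbit M d by rewrite rot_permP inE de.
  case/porbitP => t ->; elim: t => [|t IH]; first by rewrite expg0 perm1.
  rewrite expgSr permM hrot // permX.
  by elim: t {IH} => //= t IH; rewrite src_rot.
(* Every vertex of [q] is off [p], so neither rotating at it nor crossing to the next one changes
   [h]. *)
have hq : h (iter j face a) = h (iter m face a).
  move: disj qp ql; rewrite /v; move: (iter j face a) (iter m face a) => b e.
  elim: q b => [|w q IH] b disj /=.
    by move=> _ be; apply: hsrc => //; apply: disj; rewrite mem_head.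
  case/andP => bw wq qe; pose d : dart G := Sub (src b, w) bw.
  have bP : src b \notin v i :: p by apply: disj; rewrite mem_head.
  have dw : src (rev d) = w by rewrite rev_permE.
  transitivity (h (rev d)); last first.
    by apply: IH; rewrite dw // => z zq; apply: disj; rewrite in_cons zq orbT.
  have /= := hrev d; rewrite flow_notin // => /eqP; rewrite subr_eq0 => /eqP ->.
  exact: hsrc.
(* From corner [j] to corner [m] along the face, the only jump met is at [k]: [i] comes before [j],
   and [m] is less than the length of the face. *)
have hstep t : (j + t <= m)%N -> h (iter (j + t) face a) = h (iter j face a) +
    (k <= j + t)%N%:R.
  elim: t => [|t IH] le; first by rewrite addn0 leqNgt jk addr0.
  have := hface (iter (j + t) face a); rewrite /y -iterS -addnS.
  rewrite !iter_face_inj; try lia.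
  rewrite IH; last by lia.
  have -> : (k <= j + t.+1)%N = ((j + t.+1)%N == k) || (k <= j + t)%N by lia.
  have -> : ((j + t.+1)%N == i) = false by lia.
  have : ~~ (((j + t.+1)%N == k) && (k <= j + t)%N) by lia.
  by case: (_ == k); case: (k <= j + t)%N => //= _; lra.
have := hstep (m - j)%N; rewrite subnKC ?leqnn; last by lia.
rewrite hq (ltnW km) => /(_ isT) /=; lra.
Qed.

End Crossing.

(** * Crossing walks and geodesics along a face *)

Section Walks.
Variable G : sgraph.
Implicit Types (u v x y z : G) (s w p q : seq G).

Lemma reverse_walk x p : path (@adj G) x p ->
  exists q, [/\ path (@adj G) (last x p) q, last (last x p) q = x &
    last x p :: q =i x :: p].
Proof.
move=> xp; exists (rev (belast x p)); split.
- by rewrite rev_path (eq_path (e' := @adj G)) // => y z; exact: adj_sym.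
- by case: p {xp} => //= y p; rewrite rev_cons last_rcons.
by move=> z; rewrite [in RHS]lastI mem_rcons !in_cons mem_rev.
Qed.

(** Positions are interleaved rather than vertices, since a boundary walk may visit a vertex several
    times. *)
Definition paths_cross (s : seq G) := forall x0 i j k m p q,
  i < j -> j < k -> k < m -> m < size s ->
  path (@adj G) (nth x0 s i) p -> last (nth x0 s i) p = nth x0 s k ->
  path (@adj G) (nth x0 s j) q -> last (nth x0 s j) q = nth x0 s m ->
  exists2 z, z \in nth x0 s i :: p & z \in nth x0 s j :: q.

Lemma paths_cross_prefix s w : prefix s w -> paths_cross w -> paths_cross s.
Proof.
case/prefixP => t -> cross x0 i j k m p q ij jk km ms.
have sub n : n <= m -> nth x0 s n = nth x0 (s ++ t) n.
  by move=> nm; rewrite nth_cat (leq_ltn_trans nm ms).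
rewrite !sub; try lia; apply: cross => //; rewrite size_cat; lia.
Qed.

(** Reversing [s] reverses the order of the four positions: the two walks are run backwards and
    exchange roles. *)
Lemma paths_cross_rev s : paths_cross s -> paths_cross (rev s).
Proof.
move=> cross x0 i j k m p q ij jk km; rewrite size_rev => ms.
rewrite !nth_rev; try lia; move=> pp pl qp ql.
have [p' [p'p p'l p'E]] := reverse_walk pp.
have [q' [q'p q'l q'E]] := reverse_walk qp.
rewrite pl in p'p p'l p'E; rewrite ql in q'p q'l q'E.
have [||||z zq zp] := cross x0 _ _ _ _ q' p' _ _ _ _ q'p q'l p'p p'l; try lia.
by exists z; rewrite -?p'E -?q'E.
Qed.

Variable M : planar_embedding G.

Lemma boundary_paths_cross w : boundary_walk M w -> paths_cross w.
Proof.
case=> [[x _ ->]|[a ->]] x0 i j k m p q ij jk km /=; first by lia.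
rewrite size_map size_traject => mN.
have nthE n : n <= m ->
    nth x0 [seq src b | b <- traject (face_perm M) a #|porbit (face_perm M) a|]
        n =
    src (iter n (face_perm M) a).
  move=> nm; have nN := leq_ltn_trans nm mN.
  by rewrite (nth_map a) ?size_traject // nth_traject.
by rewrite !nthE; try lia; apply: face_paths_cross.
Qed.

Lemma consecutive_paths_cross s : consecutive_on_face M s -> paths_cross s.
Proof.
case=> w /boundary_paths_cross cw [] /paths_cross_prefix; apply => //.
exact: paths_cross_rev.
Qed.

Lemma boundary_connect w x y : boundary_walk M w ->
  x \in w -> y \in w -> connect (@adj G) x y.
Proof.
case=> [[z _ ->]|[a ->]].
  by rewrite !inE => /eqP -> /eqP ->; exact: connect0.
have con n : connect (@adj G) (src a) (src (iter n (face_perm M) a)).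
  elim: n => [|n IH]; first exact: connect0.
  apply: connect_trans IH _; apply: connect1.
  by rewrite iterS src_face adj_src_rev.
move=> /mapP[d /trajectP[i _ ->] ->] /mapP[e /trajectP[j _ ->] ->].
by apply: connect_trans (con j); rewrite (sym_connect_sym (@adj_sym G)).
Qed.

Lemma consecutive_connect s x y : consecutive_on_face M s ->
  x \in s -> y \in s -> connect (@adj G) x y.
Proof.
case=> w bw sw xs ys; suff sub z : z \in s -> z \in w.
  by apply: (boundary_connect bw); exact: sub.
case: sw => /prefixP[t wE] zs; first by rewrite wE mem_cat zs.
by rewrite -mem_rev wE mem_cat zs.
Qed.

Lemma dist_connect u v (uv : connect (@adj G) u v) :
  dist u v = (Posz (ex_minn (connect_walk uv)))%:E.
Proof.
rewrite /dist.
suff gen b (t : alt_spec (connect (@adj G) u v) (connect (@adj G) u v) b) :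
    match t with
    | AltTrue uv => (Posz (ex_minn (connect_walk uv)))%:E
    | AltFalse _ => +oo%E
    end = (Posz (ex_minn (connect_walk uv)))%:E :> \bar int by apply: gen.
case: t => [uv'|]; last by rewrite uv.
by rewrite (bool_irrelevance uv' uv).
Qed.

Lemma dist_notconnect u v : ~~ connect (@adj G) u v -> dist u v = +oo%E.
Proof.
move=> uv; rewrite /dist.
suff gen b (t : alt_spec (connect (@adj G) u v) (connect (@adj G) u v) b) :
    match t with
    | AltTrue uv => (Posz (ex_minn (connect_walk uv)))%:E
    | AltFalse _ => +oo%E
    end = +oo%E :> \bar int by apply: gen.
by case: t => // uv'; rewrite uv' in uv.
Qed.

(* Junk value 0 between distinct components. *)
Definition hop u v : nat := if dist u v is EFin (Posz n) then n else 0.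

Lemma hop_spec u v : connect (@adj G) u v ->
  [/\ dist u v = (Posz (hop u v))%:E,
   exists p, [/\ path (@adj G) u p, last u p = v & size p = hop u v] &
   forall p, path (@adj G) u p -> last u p = v -> hop u v <= size p].
Proof.
move=> uv; rewrite /hop dist_connect.
case: ex_minnP => n /existsP[p /andP[up /eqP pv]] nmin; split=> //.
  by exists p; rewrite size_tuple.
move=> q uq qv; apply: nmin; apply/existsP; exists (in_tuple q).
by rewrite uq qv eqxx.
Qed.

(** Exchanging the tails of the geodesics at [z] gives walks from [u] to [y] and from [v] to [x]
    with the same total length. *)
Lemma hop_exchange u v x y p q z :
  path (@adj G) u p -> last u p = x -> size p = hop u x ->
  path (@adj G) v q -> last v q = y -> size q = hop v y ->
  z \in u :: p -> z \in v :: q -> hop u y + hop v x <= hop u x + hop v y.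
Proof.
have hop_le (a b : G) r : path (@adj G) a r -> last a r = b ->
    hop a b <= size r.
  move=> ar rb; have [|_ _] := @hop_spec a b; last exact.
  by apply/connectP; exists r.
move=> up px <- vq qy <- zp zq.
case/splitPl: zp up px => p1 p2 p1z;
    rewrite cat_path last_cat p1z => /andP[up1 zp2] px.
case/splitPl: zq vq qy => q1 q2 q1z;
    rewrite cat_path last_cat q1z => /andP[vq1 zq2] qy.
have := @hop_le u y (p1 ++ q2); have := @hop_le v x (q1 ++ p2).
rewrite !cat_path !last_cat p1z q1z up1 zp2 vq1 zq2 px qy !size_cat.
move=> /(_ isT erefl) ? /(_ isT erefl) ?; lia.
Qed.

(* [hop u a + hop v b < hop u b + hop v a] compares [hop u _ - hop v _] at [a]
   and [b]; when it holds the geodesics from u to a and from v to b are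
   disjoint. *)
Lemma no_alternation s x0 u v i j k m : paths_cross s ->
  (forall x, x \in s -> connect (@adj G) u x) ->
  (forall x, x \in s -> connect (@adj G) v x) ->
  i < j -> j < k -> k < m -> m < size s ->
  (forall a b, a \in [:: i; k] -> b \in [:: j; m] ->
     hop u (nth x0 s a) + hop v (nth x0 s b) <
     hop u (nth x0 s b) + hop v (nth x0 s a)) -> False.
Proof.
move=> cross us vs ij jk km ms alt.
have ns n : n <= m -> nth x0 s n \in s.
  by move=> nm; apply: mem_nth; exact: leq_ltn_trans nm ms.
have geo (w : G) n : (forall x, x \in s -> connect (@adj G) w x) -> n <= m ->
    exists p, [/\ path (@adj G) w p,
        last w p = nth x0 s n & size p = hop w (nth x0 s n)].
  by move=> ws /ns /ws /hop_spec[].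
(* A geodesic run back to [w], then another one out of [w]; each vertex remembers a geodesic
   containing it. *)
have join (w : G) n1 n2 : (forall x, x \in s -> connect (@adj G) w x) ->
    n1 <= m -> n2 <= m ->
  exists p, [/\ path (@adj G) (nth x0 s n1) p,
      last (nth x0 s n1) p = nth x0 s n2 &
   forall z, z \in nth x0 s n1 :: p -> exists n q, [/\ n \in [:: n1; n2],
       path (@adj G) w q,
     last w q = nth x0 s n, size q = hop w (nth x0 s n) & z \in w :: q]].
  move=> ws n1m n2m; have [p1 [p1p p1l p1s]] := geo w n1 ws n1m.
  have [p2 [p2p p2l p2s]] := geo w n2 ws n2m.
  have [q []] := reverse_walk p1p; rewrite p1l => qp ql qE.
  exists (q ++ p2); split; first by rewrite cat_path qp ql p2p.
    by rewrite last_cat ql.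
  move=> z; rewrite -cat_cons mem_cat => /orP[zq|zp].
    by exists n1, p1; rewrite inE eqxx -qE.
  by exists n2, p2; rewrite !inE eqxx orbT zp orbT.
have [p [pp pl pE]] := join u i k us ltac:(lia) ltac:(lia).
have [q [qp ql qE]] := join v j m vs ltac:(lia) ltac:(lia).
have [z /pE[a [p' [aI p'p p'l p's zp]]] /qE[b [q' [bI q'p q'l q's zq]]]] :=
  cross x0 i j k m p q ij jk km ms pp pl qp ql.
have := hop_exchange p'p p'l p's q'p q'l q's zp zq.
by rewrite leqNgt (alt _ _ aI bI).
Qed.

(** In terms of [f - g], the hypotheses are a rise at [i1], a fall at [i2], a rise at [i3] and a
    fall at [i4]; sums avoid natural subtraction. *)
Lemma no_up_down_up_down s x0 u v i1 i2 i3 i4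
    (f := fun n => hop u (nth x0 s n)) (g := fun n => hop v (nth x0 s n)) :
  paths_cross s ->
  (forall x, x \in s -> connect (@adj G) u x) ->
  (forall x, x \in s -> connect (@adj G) v x) ->
  i1 < i2 -> i2 < i3 -> i3 < i4 -> i4.+1 < size s ->
  f i1 + g i1.+1 < f i1.+1 + g i1 -> f i2.+1 + g i2 < f i2 + g i2.+1 ->
  f i3 + g i3.+1 < f i3.+1 + g i3 -> f i4.+1 + g i4 < f i4 + g i4.+1 -> False.
Proof.
move=> cross us vs i12 i23 i34 i4s up1 dn2 up3 dn4.
(* The peak [h1] is the higher of [i1.+1] and [i2]; [h2] below is found likewise. *)
have [h1 [h1l h1r h1a h1b]] : exists h, [/\ i1 < h, h <= i2,
    f i1 + g h < f h + g i1 & f i2.+1 + g h < f h + g i2.+1].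
  case: (leqP (f i1.+1 + g i2) (f i2 + g i1.+1)) => ?.
    by exists i2; split=> //; lia.
  by exists i1.+1; split=> //; lia.
have [h2 [h2l h2r h2a h2b]] : exists h, [/\ i3 < h, h <= i4,
    f i3 + g h < f h + g i3 & f i4.+1 + g h < f h + g i4.+1].
  case: (leqP (f i3.+1 + g i4) (f i4 + g i3.+1)) => ?.
    by exists i4; split=> //; lia.
  by exists i3.+1; split=> //; lia.
(* The lower of [i2.+1] and [i3] lies below both peaks. *)
have [l1 [l1l l1r l1a l1b]] : exists n, [/\ i2 < n, n <= i3,
    f n + g h1 < f h1 + g n & f n + g h2 < f h2 + g n].
  case: (leqP (f i3 + g i2.+1) (f i2.+1 + g i3)) => ?.
    by exists i3; split=> //; lia.
  by exists i2.+1; split=> //; lia.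
(* The lower of the two ends lies below both peaks. If it is [i1], the pattern is low, high, low,
   high; otherwise it is high, low, high, low, with [u] and [v] exchanged. *)
case: (leqP (f i1 + g i4.+1) (f i4.+1 + g i1)) => low.
  apply: (@no_alternation s x0 u v i1 h1 l1 h2) => //; try lia.
  move=> a b; rewrite !inE => /orP[]/eqP-> /orP[]/eqP->;
    move: h1a h1b h2a h2b l1a l1b low; rewrite /f /g; lia.
apply: (@no_alternation s x0 v u h1 l1 h2 i4.+1) => //; try lia.
move=> a b; rewrite !inE => /orP[]/eqP-> /orP[]/eqP->;
  move: h1a h1b h2a h2b l1a l1b low; rewrite /f /g; lia.
Qed.

End Walks.

(** * Patterns and shattered sets *)

Section Shattering.

Lemma shatteredP (X : finType) (F : {set {set X}}) (Y : {set X}) :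
  shattered F Y -> forall P : pred X, exists2 A, A \in F & {in Y, A =i P}.
Proof.
move=> /forallP sh P; have /implyP := sh [set x in Y | P x].
have -> : [set x in Y | P x] \subset Y.
  by apply/subsetP => x; rewrite inE => /andP[].
case/(_ isT)/exists_inP => A AF /eqP YA.
by exists A => // x xY; have /setP/(_ x) := YA; rewrite !inE xY.
Qed.

Lemma card_ord_gt3 l (A : {set 'I_l}) : 3 < #|A| ->
  exists i1 i2 i3 i4 : 'I_l,
    [/\ [/\ i1 \in A, i2 \in A, i3 \in A & i4 \in A], i1 < i2,
        i2 < i3 & i3 < i4].
Proof.
have srt : sorted (fun i j : 'I_l => i < j) (enum A).
  rewrite /enum_mem; apply: sorted_filter.
    by move=> ? ? ?; exact: ltn_trans.
  have := iota_ltn_sorted 0 l; rewrite -val_enum_ord sorted_map.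
  by rewrite enumT.
rewrite cardE; have := mem_enum A.
case: (enum A) srt => [|i1 [|i2 [|i3 [|i4 r]]]] //=.
case/and4P=> i12 i23 i34 _ memA _.
by exists i1, i2, i3, i4; rewrite -!memA !inE !eqxx !orbT.
Qed.

Variables (G : sgraph) (l : nat) (s : l.-tuple G).
Implicit Types (u v : G).
Local Open Scope ring_scope.

Lemma mem_pattern x0 v (p : universe l) : (p.1.+1 < l)%N ->
  (p \in pattern s v) =
  (dist v (nth x0 s p.1) <= dist v (nth x0 s p.1.+1) + (Delta_val p.2)%:E)%E.
Proof.
move=> lt; rewrite inE; apply/existsP/idP => [[j /andP[/eqP jE]]|le].
  by rewrite inE !(tnth_nth x0) jE.
by exists (Ordinal lt); rewrite eqxx inE !(tnth_nth x0).
Qed.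

Lemma pattern_lt v p : p \in pattern s v -> (p.1.+1 < l)%N.
Proof. by rewrite inE => /existsP[j /andP[/eqP <- _]]. Qed.

Lemma pattern_mono v i (D D' : Delta_type) : Delta_val D <= Delta_val D' ->
  (i, D) \in pattern s v -> (i, D') \in pattern s v.
Proof.
move=> DD' iD; have lt := pattern_lt iD.
move: iD; rewrite !(mem_pattern (tnth s i)) // => /Order.POrderTheory.le_trans;
    apply.
by apply: leeD2l; rewrite lee_fin.
Qed.

(** If [s_(i+1)] were unreachable, the right side of the defining inequality would be [+oo] and the
    inequality would hold. *)
Lemma notin_pattern_connect x0 v (p : universe l) : (p.1.+1 < l)%N ->
  p \notin pattern s v -> connect (@adj G) v (nth x0 s p.1.+1).
Proof.
move=> lt; rewrite (mem_pattern x0) //; apply: contraR => /dist_notconnect ->.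
by rewrite addye // leey.
Qed.

Lemma mem_pattern_hop x0 v (p : universe l) : (p.1.+1 < l)%N ->
  (forall x, x \in (s : seq G) -> connect (@adj G) v x) ->
  (p \in pattern s v) =
  ((hop v (nth x0 s p.1))%:Z <= (hop v (nth x0 s p.1.+1))%:Z + Delta_val p.2).
Proof.
move=> lt vs; rewrite (mem_pattern x0) //.
have ns n : (n < l)%N -> nth x0 s n \in (s : seq G).
  by move=> nl; rewrite mem_nth // size_tuple.
have [-> _ _] := hop_spec (vs _ (ns _ (ltn_ord p.1))).
by have [-> _ _] := hop_spec (vs _ (ns _ lt)); rewrite -EFinD lee_fin.
Qed.

(** For a fixed index the two halfsets are nested, so no pattern contains the smaller [Delta]
    without the larger. *)
Lemma shattered_inj (Y : {set universe l}) :
  shattered (distance_family s) Y -> {in Y &, injective fst}.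
Proof.
move=> sh [i D] [i' D'] pY qY /= ii'; move: qY; rewrite -{i'}ii' => qY.
apply/eqP; apply/negPn/negP => neq.
have aux D1 D2 : (i, D1) \in Y -> (i, D2) \in Y -> (i, D1) != (i, D2) ->
    Delta_val D1 <= Delta_val D2 -> False.
  move=> Y1 Y2 ne le.
  have [A /imsetP[v _ ->] vP] := shatteredP sh (pred1 (i, D1)).
  have : (i, D1) \in pattern s v by rewrite vP // inE.
  by move/(pattern_mono le); rewrite vP // inE eq_sym (negPf ne).
have /orP[] := Order.TotalTheory.le_total (Delta_val D) (Delta_val D').
  exact: aux.
by apply: aux => //; rewrite eq_sym.
Qed.

End Shattering.

Theorem theorem3p7 (G : sgraph) (M : planar_embedding G) (l : nat)
  (s : l.-tuple G) (hs : consecutive_on_face M s) :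
  VC_dim (distance_family s) <= 3.
Proof.
apply/bigmax_leqP => Y sh; rewrite leqNgt -(card_in_imset (shattered_inj sh)).
apply/negP => /card_ord_gt3[i1 [i2 [i3 [i4 [[]]]]]].
move=> /imsetP[[j1 D1] Y1 ->] /imsetP[[j2 D2] Y2 ->] /imsetP[[j3 D3] Y3 ->].
move=> /imsetP[[j4 D4] Y4 ->] /= j12 j23 j34.
pose x0 := tnth s j1.
(* Some pattern contains all of [Y], whereas no pattern contains a pair with the last index. *)
have lt p : p \in Y -> p.1.+1 < l.
  have [A /imsetP[v _ ->] vP] := shatteredP sh predT.
  by move=> pY; apply: (@pattern_lt G l s v p); rewrite (vP p pY).
(* One missing element makes all distances from [v] to [s] finite, because the vertices of [s] are
   connected along the face. *)
have spread v p : p \in Y -> p \notin pattern s v ->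
    forall x, x \in (s : seq G) -> connect (@adj G) v x.
  move=> pY pv x xs.
  apply: connect_trans (notin_pattern_connect x0 (lt p pY) pv) _.
  by apply: (consecutive_connect hs) => //; rewrite mem_nth // size_tuple lt.
have [A /imsetP[u _ ->] uP] :=
    shatteredP sh (fun p => (p.1 == j1) || (p.1 == j3)).
have [B /imsetP[v _ ->] vP] :=
    shatteredP sh (fun p => (p.1 == j2) || (p.1 == j4)).
have neq (a b : 'I_l) : a < b -> ((a == b) = false) * ((b == a) = false).
  by move=> ab; split; apply/eqP => E; rewrite E ltnn in ab.
have N := (neq _ _ j12, neq _ _ j23, neq _ _ j34, neq _ _ (ltn_trans j12 j23),
  neq _ _ (ltn_trans j23 j34), neq _ _ (ltn_trans j12 (ltn_trans j23 j34))).
have us := spread u _ Y2; have vs := spread v _ Y1.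
rewrite uP // /in_mem /= !N in us; rewrite vP // /in_mem /= !N in vs.
move: us vs => /(_ isT) us /(_ isT) vs.
have hu p : p \in Y -> _ := fun pY => mem_pattern_hop x0 (lt p pY) us.
have hv p : p \in Y -> _ := fun pY => mem_pattern_hop x0 (lt p pY) vs.
have := (hu _ Y1, hu _ Y2, hu _ Y3, hu _ Y4).
have := (hv _ Y1, hv _ Y2, hv _ Y3, hv _ Y4).
rewrite !uP // !vP // /in_mem /= !eqxx !N /=.
move=> [[[v1 v2] v3] v4] [[[u1 u2] u3] u4].
apply: (@no_up_down_up_down G s x0 u v j1 j2 j3 j4) => //.
- exact: consecutive_paths_cross hs.
- by rewrite size_tuple; exact: (lt _ Y4).
(* One of [u], [v] satisfies the inequality and the other violates it with the same [Delta], which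
   cancels when the two are added. *)
- move: u1 v1; lia.
- move: u2 v2; lia.
- move: u3 v3; lia.
- move: u4 v4; lia.
Qed.
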